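(* Let $O\neq P$ be points of $\mathcal{P}$, let $\mathcal{P}_l$ be the set of points on the line $l_{OP}$ and $\mathcal{P}_{l_A}$ the set of arrows with tail and head in $\mathcal{P}_l$. Let $\overrightarrow{AB},\overrightarrow{CD},\overrightarrow{EF},\overrightarrow{GH}\in\mathcal{P}_{l_A}$ be such that $\overrightarrow{AB}\;\Re_l\;\overrightarrow{CD}$ and $\overrightarrow{EF}\;\Re_l\;\overrightarrow{GH}$. Then $\langle\overrightarrow{AB},\overrightarrow{EF}\rangle_A=\langle\overrightarrow{CD},\overrightarrow{GH}\rangle_A$.
   Context: Let $\mathcal{P}$ be a set whose elements are called points. An arrow is an ordered pair of points $\overrightarrow{AB}=(A,B)$ (tail $A$, head $B$; $A=B$ is allowed). The arrow space $\mathcal{P}_A$ is the set of all arrows; two arrows are equal iff they have the same tail and the same head. Negation: $-\overrightarrow{AB}=\overrightarrow{BA}$. Arrow addition is the partial operation $\overrightarrow{AB}+_A\overrightarrow{BC}=\overrightarrow{AC}$, defined exactly when the head of the first arrow equals the tail of the second. Axiom 1: there is a given map (arrow pre-inner product) $\langle -,-\rangle_A:\mathcal{P}_A\times\mathcal{P}_A\to\mathbb{R}$ such that for all points: $\langle\overrightarrow{AB},\overrightarrow{AB}\rangle_A\ge 0$, with equality iff $A=B$; $\langle\overrightarrow{AB},\overrightarrow{CD}\rangle_A=\langle\overrightarrow{CD},\overrightarrow{AB}\rangle_A$; $\langle\overrightarrow{AB}+_A\overrightarrow{BC},\overrightarrow{LM}\rangle_A=\langle\overrightarrow{AB},\overrightarrow{LM}\rangle_A+\langle\overrightarrow{BC},\overrightarrow{LM}\rangle_A$;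 $\langle-\overrightarrow{AB},\overrightarrow{CD}\rangle_A=-\langle\overrightarrow{AB},\overrightarrow{CD}\rangle_A$. Measure: $\|\overrightarrow{AB}\|_A=\sqrt{\langle\overrightarrow{AB},\overrightarrow{AB}\rangle_A}$. Scalar multiplication: for $t\in\mathbb{R}$, if $A=B$ or $t=0$ then $(t)\overrightarrow{AB}=\overrightarrow{AA}$. If $A\ne B$ and $t\neq0$ then $(t)\overrightarrow{AB}=\overrightarrow{AD}$, where $D\in\mathcal{P}$ is a point (assumed to exist) with $\|\overrightarrow{AD}\|_A=|t|\,\|\overrightarrow{AB}\|_A$ and $\langle\overrightarrow{AB},\overrightarrow{AD}\rangle_A=\|\overrightarrow{AB}\|_A\|\overrightarrow{AD}\|_A$ if $t>0$, $=-\|\overrightarrow{AB}\|_A\|\overrightarrow{AD}\|_A$ if $t<0$. Axiom 2: $\langle(t)\overrightarrow{AB},\overrightarrow{CD}\rangle_A=t\langle\overrightarrow{AB},\overrightarrow{CD}\rangle_A$ for all arrows and all $t\in\mathbb{R}$. Line: for distinct points $O,P$, $l_{OP}=\{C\in\mathcal{P}:\ \exists t\in\mathbb{R},\ \overrightarrow{OC}=(t)\overrightarrow{OP}\}$. Axiom 3: for every line there is a one-to-one correspondence between $\mathbb{R}$ and the set of points on the line. Relation $\Re_l$ on $\mathcal{P}_{l_A}$: $\overrightarrow{AB}\;\Re_l\;\overrightarrow{CD}$ iff either $A=B$ and $C=D$, or ($A\ne B$, $C\neq D$ and) $\|\overrightarrow{AB}\|_A=\|\overrightarrow{CD}\|_A$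 and $\frac{\langle\overrightarrow{AB},\overrightarrow{CD}\rangle_A}{\|\overrightarrow{AB}\|_A\|\overrightarrow{CD}\|_A}=1$. *)

(* Defs.v *)
From Stdlib Require Import Reals.
Open Scope R_scope.

Definition arrow (point : Type) : Type := (point * point)%type.

Definition tail {point : Type} (a : arrow point) : point := fst a.
Definition head {point : Type} (a : arrow point) : point := snd a.

Definition arrow_opp {point : Type} (a : arrow point) : arrow point :=
  (head a, tail a).

(* Partial operation: the proof argument is the condition for being defined. *)
Definition arrow_add {point : Type} (a b : arrow point)
  (_ : head a = tail b) : arrow point := (tail a, head b).

Record arrow_pre_inner_product {point : Type}
    (ip : arrow point -> arrow point -> R) : Prop := {
  ip_ge0 : forall A B, 0 <= ip (A, B) (A, B);
  ip_eq0 : forall A B, ip (A, B) (A, B) = 0 <-> A = B;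
  ip_sym : forall A B C D, ip (A, B) (C, D) = ip (C, D) (A, B);
  ip_add : forall A B C L M,
    ip (arrow_add (A, B) (B, C) eq_refl) (L, M)
    = ip (A, B) (L, M) + ip (B, C) (L, M);
  ip_opp : forall A B C D,
    ip (arrow_opp (A, B)) (C, D) = - ip (A, B) (C, D)
}.

Definition arrow_norm {point : Type} (ip : arrow point -> arrow point -> R)
  (a : arrow point) : R := sqrt (ip a a).

(* The specification does not by itself determine the head D, so scalar
   multiplication is any function that meets it; the existence of such a
   function is the assumed existence of the points D. *)
Record scalar_multiplication {point : Type}
    (ip : arrow point -> arrow point -> R)
    (smul : R -> arrow point -> arrow point) : Prop := {
  smul_degenerate : forall t A B, A = B \/ t = 0 -> smul t (A, B) = (A, A);
  smul_proper : forall t A B, A <> B -> t <> 0 ->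
    exists D, smul t (A, B) = (A, D)
      /\ arrow_norm ip (A, D) = Rabs t * arrow_norm ip (A, B)
      /\ (0 < t ->
          ip (A, B) (A, D) = arrow_norm ip (A, B) * arrow_norm ip (A, D))
      /\ (t < 0 ->
          ip (A, B) (A, D) = - (arrow_norm ip (A, B) * arrow_norm ip (A, D)))
}.

Definition smul_homogeneous {point : Type}
  (ip : arrow point -> arrow point -> R)
  (smul : R -> arrow point -> arrow point) : Prop :=
  forall t A B C D, ip (smul t (A, B)) (C, D) = t * ip (A, B) (C, D).

Definition line {point : Type} (smul : R -> arrow point -> arrow point)
  (O P : point) (C : point) : Prop :=
  exists t : R, (O, C) = smul t (O, P).

(* A bijection from R onto a line, as an injection whose image is the line. *)
Definition lines_equipotent_to_R {point : Type}
  (smul : R -> arrow point -> arrow point) : Prop :=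
  forall O P : point, O <> P ->
  exists f : R -> point,
    (forall s t, f s = f t -> s = t)
    /\ (forall C, line smul O P C <-> exists t, f t = C).

Definition line_arrow {point : Type} (smul : R -> arrow point -> arrow point)
  (O P : point) (a : arrow point) : Prop :=
  line smul O P (tail a) /\ line smul O P (head a).

(* The defining formula does not mention the line; it is meant for arrows of
   one and the same line. *)
Definition arrow_rel {point : Type} (ip : arrow point -> arrow point -> R)
  (a b : arrow point) : Prop :=
  (tail a = head a /\ tail b = head b)
  \/ (tail a <> head a /\ tail b <> head b
      /\ arrow_norm ip a = arrow_norm ip b
      /\ ip a b / (arrow_norm ip a * arrow_norm ip b) = 1).

(* Main.v *)
(** By axiom 2, pairing with an arrow of the line [l_OP] is a multiple [s] of
    pairing with [OP]. Arrows [a], [b] related by [Re_l] satisfy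
    [<a,a> = <a,b> = <b,b>], that is [s^2 = s t = t^2] for their coefficients;
    hence [(s - t)^2 = 0], so related arrows pair identically with
    everything. *)
Require Import Defs.
From Stdlib Require Import Reals Lra.
Open Scope R_scope.

Lemma arrow_ip_sym {point : Type} (ip : arrow point -> arrow point -> R)
  (axiom1 : arrow_pre_inner_product ip) (a b : arrow point) :
  ip a b = ip b a.
Proof. destruct a, b; apply (ip_sym ip axiom1). Qed.

Lemma arrow_ip_ge0 {point : Type} (ip : arrow point -> arrow point -> R)
  (axiom1 : arrow_pre_inner_product ip) (a : arrow point) : 0 <= ip a a.
Proof. destruct a; apply (ip_ge0 ip axiom1). Qed.

Lemma ip_chasles {point : Type} (ip : arrow point -> arrow point -> R)
  (axiom1 : arrow_pre_inner_product ip) (A B C : point) (x : arrow point) :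
  ip (A, C) x = ip (A, B) x + ip (B, C) x.
Proof. destruct x as [L M]; exact (ip_add ip axiom1 A B C L M). Qed.

Lemma ip_point {point : Type} (ip : arrow point -> arrow point -> R)
  (axiom1 : arrow_pre_inner_product ip) (A : point) (x : arrow point) :
  ip (A, A) x = 0.
Proof. generalize (ip_chasles ip axiom1 A A A x); lra. Qed.

(** If [OA] is [s] times [OP] and [OB] is [t] times [OP], then [OA + AB = OB] and homogeneity give
    [AB] the coefficient [t - s]. *)
Lemma line_arrow_coef {point : Type}
  (ip : arrow point -> arrow point -> R)
  (smul : R -> arrow point -> arrow point)
  (axiom1 : arrow_pre_inner_product ip) (axiom2 : smul_homogeneous ip smul)
  (O P : point) (a : arrow point) (la : line_arrow smul O P a) :
  exists s : R, forall x, ip a x = s * ip (O, P) x.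
Proof.
  destruct a as [A B], la as [[s hs] [t ht]]; simpl in hs, ht.
  exists (t - s); intros [L M].
  generalize (ip_chasles ip axiom1 O A B (L, M)).
  rewrite hs, ht, !axiom2; lra.
Qed.

(** Cosine 1 makes [ip a b] the product of the two norms, and since these are equal it is the square
    of each. For two degenerate arrows all three pairings vanish. *)
Lemma arrow_rel_ip {point : Type} (ip : arrow point -> arrow point -> R)
  (axiom1 : arrow_pre_inner_product ip) (a b : arrow point)
  (rel : arrow_rel ip a b) : ip a a = ip a b /\ ip b b = ip a b.
Proof.
  destruct rel as [[ea eb] | (_ & _ & eqn & cos1)].
  - destruct a as [A A'], b as [B B']; simpl in ea, eb; subst A' B'.
    now rewrite !(ip_point ip axiom1).
  - generalize (sqrt_sqrt _ (arrow_ip_ge0 ip axiom1 a))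
      (sqrt_sqrt _ (arrow_ip_ge0 ip axiom1 b)).
    fold (arrow_norm ip a) (arrow_norm ip b); intros na nb.
    (* Both norms are now that of [a], so the denominator of the cosine becomes [ip a a]. *)
    rewrite <- eqn in cos1, nb; rewrite na in cos1.
    (* a zero norm would make the quotient x / 0 = 0, not 1 *)
    assert (naa : ip a a <> 0).
    { intros z; rewrite z in cos1; unfold Rdiv in cos1.
      rewrite Rinv_0 in cos1; lra. }
    assert (ab : ip a b = ip a a).
    { rewrite <- (Rmult_1_l (ip a a)), <- cos1; field; exact naa. }
    lra.
Qed.

Lemma line_arrow_rel_ip {point : Type}
  (ip : arrow point -> arrow point -> R)
  (smul : R -> arrow point -> arrow point)
  (axiom1 : arrow_pre_inner_product ip) (axiom2 : smul_homogeneous ip smul)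
  (O P : point) (neqOP : O <> P) (a b : arrow point)
  (la : line_arrow smul O P a) (lb : line_arrow smul O P b)
  (rel : arrow_rel ip a b) (x : arrow point) : ip a x = ip b x.
Proof.
  destruct (line_arrow_coef ip smul axiom1 axiom2 O P a la) as [s hs].
  destruct (line_arrow_coef ip smul axiom1 axiom2 O P b lb) as [t ht].
  destruct (arrow_rel_ip ip axiom1 a b rel) as [eaa ebb].
  assert (k0 : ip (O, P) (O, P) <> 0).
  { intros z; apply neqOP, (ip_eq0 ip axiom1), z. }
  (* With [k] the pairing of [OP] with itself, the two hypotheses become [s s k = s t k] and
     [t t k = s t k]; they combine to [(s - t)^2 k = 0], and [k] cancels. *)
  rewrite !hs, !(arrow_ip_sym ip axiom1 (O, P)), hs, ht in eaa.
  rewrite hs, ht, !(arrow_ip_sym ip axiom1 (O, P)), ht in ebb.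
  assert (sq : Rsqr (s - t) = 0).
  { apply (Rmult_eq_reg_r (ip (O, P) (O, P))); [unfold Rsqr; lra | exact k0]. }
  apply Rsqr_0_uniq in sq.
  rewrite hs, ht; f_equal; lra.
Qed.

Theorem theorem37 (point : Type)
  (ip : arrow point -> arrow point -> R)
  (smul : R -> arrow point -> arrow point)
  (axiom1 : arrow_pre_inner_product ip)
  (smulP : scalar_multiplication ip smul)
  (axiom2 : smul_homogeneous ip smul)
  (axiom3 : lines_equipotent_to_R smul)
  (O P : point) (neqOP : O <> P)
  (A B C D E F G H : point)
  (lAB : line_arrow smul O P (A, B)) (lCD : line_arrow smul O P (C, D))
  (lEF : line_arrow smul O P (E, F)) (lGH : line_arrow smul O P (G, H))
  (relABCD : arrow_rel ip (A, B) (C, D))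
  (relEFGH : arrow_rel ip (E, F) (G, H)) :
  ip (A, B) (E, F) = ip (C, D) (G, H).
Proof.
  rewrite (line_arrow_rel_ip ip smul axiom1 axiom2 O P neqOP _ _ lAB lCD relABCD).
  (* Symmetry brings [EF] and [GH] into the first slot, where related arrows can be exchanged. *)
  rewrite !(arrow_ip_sym ip axiom1 (C, D)).
  exact (line_arrow_rel_ip ip smul axiom1 axiom2 O P neqOP _ _ lEF lGH relEFGH _).
Qed.
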